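(* Let $\Sigma=(I,\preceq,f)$ be a subexponential signature such that for all labels $i\in I$ we have $f(i)\subseteq\{\mathsf{C},\mathsf{W},\mathsf{E}\}$. Then an $\mathsf{acLL}_\Sigma$ sequent $\Gamma\Rightarrow A$ is provable in $\mathsf{acLL}_\Sigma$ if and only if $\vdash(\widehat{\Gamma}^{\perp},\widehat{A})$ is provable in $\mathsf{CacLL}_\Sigma$.
   Context: $\mathsf{CacLL}_\Sigma$ is the one-sided classical non-associative non-commutative linear logic with subexponentials: sequents are $\vdash\Gamma$ where $\Gamma$ is a non-empty structure, i.e. a binary tree of formulae built as $\Gamma::=\varnothing\mid F\mid(\Gamma,\Gamma)$ (empty substructures are erased). Its rules are the multiplicative rules for $\otimes$ and par ($⅋$), additive rules for $\oplus$ and with ($\mathbin{\&}$), rules for $\bot,\mathsf{1},\top$, top-level exchange $(\Gamma,\Delta)$ to $(\Delta,\Gamma)$ and top-level associativity, initial sequents $\vdash(A,A^\perp)$ and cut, plus subexponential rules ($!^i,?^i$ promotion and dereliction, and $?$-licensed weakening, contraction, exchange and associativity) for a simply dependent multimodal signature $\Sigma=(I,\preceq,f)$ where $(I,\preceq)$ is a preorder and $f:I\to 2^{\{\mathsf{C},\mathsf{W},\mathsf{A1},\mathsf{A2},\mathsf{E}\}}$ is upward closed. $\mathsf{acLL}_\Sigma$ is the intuitionistic two-sided counterpart: sequents $\Gamma\Rightarrow A$ with a structure (binary tree) $\Gamma$ as antecedent and a single succedent formula, connectives $\mathbin{\&},\oplus,\otimes,\to,\leftarrow,\top,!^i,\mathsf{1}$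 (where $\to,\leftarrow$ are the non-commutative linear implications), with subexponential rules licensed by the same signature. The translation $\widehat{\cdot}$ from $\mathsf{acLL}$ formulae to $\mathsf{CacLL}$ formulae is: $\widehat{p}=p$, $\widehat{A\otimes B}=\widehat{A}\otimes\widehat{B}$, $\widehat{A\to B}=\widehat{A}^{\perp}⅋\widehat{B}$, $\widehat{B\leftarrow A}=\widehat{B}⅋\widehat{A}^{\perp}$, $\widehat{A\mathbin{\&}B}=\widehat{A}\mathbin{\&}\widehat{B}$, $\widehat{A\oplus B}=\widehat{A}\oplus\widehat{B}$, $\widehat{!^iA}=!^i\widehat{A}$, $\widehat{\mathsf{1}}=\mathsf{1}$, $\widehat{\top}=\top$; here $F^\perp$ denotes the De Morgan dual of $F$ (negation pushed to atoms). It is extended to antecedent structures by $\widehat{(\Gamma,\Delta)}^{\perp}=(\widehat{\Delta}^{\perp},\widehat{\Gamma}^{\perp})$. *)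

(* Defs.v *)
From Stdlib Require Import RelationClasses.

Set Implicit Arguments.
Unset Strict Implicit.
Unset Printing Implicit Defensive.

Inductive ax := AxC | AxW | AxA1 | AxA2 | AxE.

Record signature := Signature {
  label :> Type;
  label_le : label -> label -> Prop;
  label_preorder : PreOrder label_le;
  axioms : label -> ax -> Prop;
  axioms_upward : forall i j a, label_le i j -> axioms i a -> axioms j a
}.

(** Structures are binary trees of formulae in which empty substructures are
    erased.  The normal forms of the grammar
      Gamma ::= empty | F | (Gamma, Gamma)
    for this erasure are: the empty structure, or a binary tree with formulae
    at its leaves.  [pair] is the structure (Gamma, Delta), with erasure. *)
Inductive tree (F : Type) : Type :=
| Leaf (A : F)
| Node (s t : tree F).

Definition structure (F : Type) := option (tree F).

Definition empty {F : Type} : structure F := None.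

Definition form {F : Type} (A : F) : structure F := Some (Leaf A).

Definition pair {F : Type} (G D : structure F) : structure F :=
  match G, D with
  | None, _ => D
  | _, None => G
  | Some s, Some t => Some (Node s t)
  end.

Inductive context (F : Type) : Type :=
| Hole
| CtxL (K : context F) (D : structure F)
| CtxR (G : structure F) (K : context F).
Arguments Hole {F}.

Fixpoint fill {F : Type} (K : context F) (D : structure F) : structure F :=
  match K with
  | Hole => D
  | CtxL K' D' => pair (fill K' D) D'
  | CtxR G' K' => pair G' (fill K' D)
  end.

(** A context with two holes is an outer context around a pair of two one-hole
    contexts, according to the node at which the paths to the holes part. *)
Definition fill2 {F : Type} (K K1 K2 : context F) (D1 D2 : structure F) :
    structure F :=
  fill K (pair (fill K1 D1) (fill K2 D2)).

(** In the next two definitions [mod i A] stands for [!^i A] in the two-sided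
    calculus and for [?^i A] in the one-sided one.

    [licensed mod a D]: all the leaves of [D] are of the form [mod i A] with
    [a] in [f(i)] (the structures written !^a D, resp. ?^a D, in the structural
    rules). *)
Inductive licensed (Sg : signature) (F : Type) (mod : Sg -> F -> F) (a : ax) :
    structure F -> Prop :=
| licensed_empty : licensed mod a empty
| licensed_form i A : axioms i a -> licensed mod a (form (mod i A))
| licensed_pair G D :
    licensed mod a G -> licensed mod a D -> licensed mod a (pair G D).

(** [upset mod i G G']: all the leaves of [G] are of the form [mod j A], those
    with [j] not above [i] admit weakening, and [G'] is obtained from [G] by
    erasing the latter. *)
Inductive upset (Sg : signature) (F : Type) (mod : Sg -> F -> F) (i : Sg) :
    structure F -> structure F -> Prop :=
| upset_empty : upset mod i empty empty
| upset_keep j A :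
    label_le i j -> upset mod i (form (mod j A)) (form (mod j A))
| upset_erase k A :
    ~ label_le i k -> axioms k AxW -> upset mod i (form (mod k A)) empty
| upset_pair G G' D D' :
    upset mod i G G' -> upset mod i D D' ->
    upset mod i (pair G D) (pair G' D').

(** * The intuitionistic calculus acLL *)

Inductive iform (P I : Type) : Type :=
| IAtom (p : P)
| ITensor (A B : iform P I)
| IImp (A B : iform P I)      (* A -> B *)
| IPmi (B A : iform P I)      (* B <- A *)
| IWith (A B : iform P I)
| IPlus (A B : iform P I)
| IBang (i : I) (A : iform P I)
| IOne
| ITop.
Arguments IAtom {P I}.
Arguments IOne {P I}.
Arguments ITop {P I}.

Inductive acLL (P : Type) (Sg : signature) :
    structure (iform P Sg) -> iform P Sg -> Prop :=
| i_init A : acLL (form A) A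
| i_cut K D A B :
    acLL D A -> acLL (fill K (form A)) B -> acLL (fill K D) B
| i_tensorL K A B C :
    acLL (fill K (pair (form A) (form B))) C ->
    acLL (fill K (form (ITensor A B))) C
| i_tensorR G D A B :
    acLL G A -> acLL D B -> acLL (pair G D) (ITensor A B)
| i_impL K D A B C :
    acLL D A -> acLL (fill K (form B)) C ->
    acLL (fill K (pair D (form (IImp A B)))) C
| i_impR G A B :
    acLL (pair (form A) G) B -> acLL G (IImp A B)
| i_pmiL K D A B C :
    acLL D A -> acLL (fill K (form B)) C ->
    acLL (fill K (pair (form (IPmi B A)) D)) C
| i_pmiR G A B :
    acLL (pair G (form A)) B -> acLL G (IPmi B A)
| i_withL1 K A B C :
    acLL (fill K (form A)) C -> acLL (fill K (form (IWith A B))) C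
| i_withL2 K A B C :
    acLL (fill K (form B)) C -> acLL (fill K (form (IWith A B))) C
| i_withR G A B :
    acLL G A -> acLL G B -> acLL G (IWith A B)
| i_plusL K A B C :
    acLL (fill K (form A)) C -> acLL (fill K (form B)) C ->
    acLL (fill K (form (IPlus A B))) C
| i_plusR1 G A B : acLL G A -> acLL G (IPlus A B)
| i_plusR2 G A B : acLL G B -> acLL G (IPlus A B)
| i_oneL K C :
    acLL (fill K empty) C -> acLL (fill K (form IOne)) C
| i_oneR : acLL empty IOne
| i_topR G : acLL G ITop
| i_bangL K i A C :
    acLL (fill K (form A)) C -> acLL (fill K (form (IBang i A))) C
| i_bangR G G' i A :
    upset (@IBang P Sg) i G G' -> acLL G' A -> acLL G (IBang i A)
| i_W K D C :
    licensed (@IBang P Sg) AxW D ->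
    acLL (fill K empty) C -> acLL (fill K D) C
| i_C1 K K1 K2 D C :
    licensed (@IBang P Sg) AxC D ->
    acLL (fill2 K K1 K2 D D) C -> acLL (fill2 K K1 K2 D empty) C
| i_C2 K K1 K2 D C :
    licensed (@IBang P Sg) AxC D ->
    acLL (fill2 K K1 K2 D D) C -> acLL (fill2 K K1 K2 empty D) C
| i_E1 K D1 D2 C :
    licensed (@IBang P Sg) AxE D1 ->
    acLL (fill K (pair D2 D1)) C -> acLL (fill K (pair D1 D2)) C
| i_E2 K D1 D2 C :
    licensed (@IBang P Sg) AxE D2 ->
    acLL (fill K (pair D2 D1)) C -> acLL (fill K (pair D1 D2)) C
| i_A1 K D1 D2 D3 C :
    licensed (@IBang P Sg) AxA1 D1 ->
    acLL (fill K (pair (pair D1 D2) D3)) C ->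
    acLL (fill K (pair D1 (pair D2 D3))) C
| i_A2 K D1 D2 D3 C :
    licensed (@IBang P Sg) AxA2 D3 ->
    acLL (fill K (pair D1 (pair D2 D3))) C ->
    acLL (fill K (pair (pair D1 D2) D3)) C.

(** * The classical calculus CacLL *)

Inductive cform (P I : Type) : Type :=
| CAtom (p : P)
| CNAtom (p : P)
| CTensor (A B : cform P I)
| CPar (A B : cform P I)
| CWith (A B : cform P I)
| CPlus (A B : cform P I)
| CBang (i : I) (A : cform P I)
| CQuest (i : I) (A : cform P I)
| COne
| CBot
| CTop
| CZero.
Arguments CAtom {P I}.
Arguments CNAtom {P I}.
Arguments COne {P I}.
Arguments CBot {P I}.
Arguments CTop {P I}.
Arguments CZero {P I}.

(** In the absence of exchange, duality reverses the multiplicatives. *)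
Fixpoint dual (P I : Type) (A : cform P I) : cform P I :=
  match A with
  | CAtom p => CNAtom p
  | CNAtom p => CAtom p
  | CTensor A B => CPar (dual B) (dual A)
  | CPar A B => CTensor (dual B) (dual A)
  | CWith A B => CPlus (dual A) (dual B)
  | CPlus A B => CWith (dual A) (dual B)
  | CBang i A => CQuest i (dual A)
  | CQuest i A => CBang i (dual A)
  | COne => CBot
  | CBot => COne
  | CTop => CZero
  | CZero => CTop
  end.

(** [CacLL G] is the derivability of the sequent |- G.  The only rule that
    could produce an empty sequent from non-empty ones is cut, hence its side
    condition.  There is no rule for [CZero].  Duality reverses structures, so
    the rules for A1 and A2 are the mirror images of those of [acLL]. *)
Inductive CacLL (P : Type) (Sg : signature) :
    structure (cform P Sg) -> Prop :=
| c_init A : CacLL (pair (form A) (form (dual A)))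
| c_cut G D A :
    pair G D <> empty ->
    CacLL (pair G (form A)) -> CacLL (pair (form (dual A)) D) ->
    CacLL (pair G D)
| c_exch G D : CacLL (pair G D) -> CacLL (pair D G)
| c_assocl G D T :
    CacLL (pair G (pair D T)) -> CacLL (pair (pair G D) T)
| c_assocr G D T :
    CacLL (pair (pair G D) T) -> CacLL (pair G (pair D T))
| c_tensor G D A B :
    CacLL (pair G (form A)) -> CacLL (pair D (form B)) ->
    CacLL (pair (pair D G) (form (CTensor A B)))
| c_par K A B :
    CacLL (fill K (pair (form A) (form B))) ->
    CacLL (fill K (form (CPar A B)))
| c_with K A B :
    CacLL (fill K (form A)) -> CacLL (fill K (form B)) ->
    CacLL (fill K (form (CWith A B)))
| c_plus1 K A B :
    CacLL (fill K (form A)) -> CacLL (fill K (form (CPlus A B)))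
| c_plus2 K A B :
    CacLL (fill K (form B)) -> CacLL (fill K (form (CPlus A B)))
| c_one : CacLL (form COne)
| c_bot K : CacLL (fill K empty) -> CacLL (fill K (form CBot))
| c_top K : CacLL (fill K (form CTop))
| c_quest K i A :
    CacLL (fill K (form A)) -> CacLL (fill K (form (CQuest i A)))
| c_bang G G' i A :
    upset (@CQuest P Sg) i G G' ->
    CacLL (pair G' (form A)) -> CacLL (pair G (form (CBang i A)))
| c_W K D :
    licensed (@CQuest P Sg) AxW D ->
    CacLL (fill K empty) -> CacLL (fill K D)
| c_C1 K K1 K2 D :
    licensed (@CQuest P Sg) AxC D ->
    CacLL (fill2 K K1 K2 D D) -> CacLL (fill2 K K1 K2 D empty)
| c_C2 K K1 K2 D :
    licensed (@CQuest P Sg) AxC D ->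
    CacLL (fill2 K K1 K2 D D) -> CacLL (fill2 K K1 K2 empty D)
| c_E1 K D1 D2 :
    licensed (@CQuest P Sg) AxE D1 ->
    CacLL (fill K (pair D2 D1)) -> CacLL (fill K (pair D1 D2))
| c_E2 K D1 D2 :
    licensed (@CQuest P Sg) AxE D2 ->
    CacLL (fill K (pair D2 D1)) -> CacLL (fill K (pair D1 D2))
| c_A1 K D1 D2 D3 :
    licensed (@CQuest P Sg) AxA1 D3 ->
    CacLL (fill K (pair D1 (pair D2 D3))) ->
    CacLL (fill K (pair (pair D1 D2) D3))
| c_A2 K D1 D2 D3 :
    licensed (@CQuest P Sg) AxA2 D1 ->
    CacLL (fill K (pair (pair D1 D2) D3)) ->
    CacLL (fill K (pair D1 (pair D2 D3))).

(** * The translation *)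

Fixpoint hat (P I : Type) (A : iform P I) : cform P I :=
  match A with
  | IAtom p => CAtom p
  | ITensor A B => CTensor (hat A) (hat B)
  | IImp A B => CPar (dual (hat A)) (hat B)
  | IPmi B A => CPar (hat B) (dual (hat A))
  | IWith A B => CWith (hat A) (hat B)
  | IPlus A B => CPlus (hat A) (hat B)
  | IBang i A => CBang i (hat A)
  | IOne => COne
  | ITop => CTop
  end.

Fixpoint hat_dual_tree (P I : Type) (t : tree (iform P I)) :
    structure (cform P I) :=
  match t with
  | Leaf A => form (dual (hat A))
  | Node s t => pair (hat_dual_tree t) (hat_dual_tree s)
  end.

Definition hat_dual (P I : Type) (G : structure (iform P I)) :
    structure (cform P I) :=
  match G with
  | None => empty
  | Some t => hat_dual_tree t
  end.

(* Main.v *)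
(** Soundness of the translation is an induction on intuitionistic derivations:
    top-level exchange and associativity bring any position of a one-sided
    sequent to the root, where cut and [c_tensor] apply.

    Faithfulness is proved without cut elimination, by soundness of [CacLL] for
    a phase semantics.  A point of the phase space is a one-sided structure all
    of whose leaves are translated formulae or their duals, classified by its
    number of undualized leaves: an antecedent [Neg G] (none), an antecedent
    context together with a succedent [Pos K C] (exactly one; the hole of [K] is
    the root of the one-sided structure), or [Many].  The pole consists of all
    the points [Many] and of the points [Pos K C] whose sequent is derivable in
    [acLL].  A [Neg] point is never in the pole, so that in the tensor rule the
    undualized formula cannot end up in the wrong premise; that [Many] always
    is in the pole accounts for [CTop].  Since the pole
    is invariant under the top-level rules, every formula denotes a
    biorthogonally closed set, and by induction on [A] the antecedent [A]
    belongs to the denotation of [hat A], which is orthogonal to the succedent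
    [A]. *)

Require Import Defs.
From Stdlib Require Import ssreflect Setoid.

Set Implicit Arguments.
Unset Strict Implicit.
Unset Printing Implicit Defensive.

Lemma pairG0 (F : Type) (G : structure F) : pair G empty = G.
Proof. by case: G. Qed.

Lemma pair_neq0 (F : Type) (G D : structure F) : D <> empty -> pair G D <> empty.
Proof. by case: G D => [s|] [t|]. Qed.

Fixpoint compose (F : Type) (K L : context F) : context F :=
  match K with
  | Hole => L
  | CtxL K D => CtxL (compose K L) D
  | CtxR G K => CtxR G (compose K L)
  end.

Lemma fill_compose (F : Type) (K L : context F) D :
  fill (compose K L) D = fill K (fill L D).
Proof. by elim: K => [//|K IH D'|G K IH] /=; rewrite IH. Qed.

(** * Soundness of the translation *)

Section Soundness.

Context (P : Type) (Sg : signature).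

Notation iformula := (iform P Sg).
Notation cformula := (cform P Sg).

Lemma dual_dual (A : cformula) : dual (dual A) = A.
Proof. by elim: A => //= [A -> B -> |A -> B -> |A -> B -> |A -> B -> |i A ->|i A ->]. Qed.

Lemma hat_dual_pair (G D : structure iformula) :
  hat_dual (pair G D) = pair (hat_dual D) (hat_dual G).
Proof. by case: G D => [s|] [t|] //=; rewrite pairG0. Qed.

Fixpoint hat_dual_context (K : context iformula) : context cformula :=
  match K with
  | Hole => Hole
  | CtxL K D => CtxR (hat_dual D) (hat_dual_context K)
  | CtxR G K => CtxL (hat_dual_context K) (hat_dual G)
  end.

Lemma hat_dual_fill K D :
  hat_dual (fill K D) = fill (hat_dual_context K) (hat_dual D).
Proof. by elim: K => [//|K IH D'|G K IH] /=; rewrite hat_dual_pair IH. Qed.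

Lemma hat_dual_fill2 K K1 K2 D1 D2 :
  hat_dual (fill2 K K1 K2 D1 D2) =
  fill2 (hat_dual_context K) (hat_dual_context K2) (hat_dual_context K1)
    (hat_dual D2) (hat_dual D1).
Proof. by rewrite /fill2 hat_dual_fill hat_dual_pair !hat_dual_fill. Qed.

Lemma licensed_hat_dual a (G : structure iformula) :
  licensed (@IBang P Sg) a G -> licensed (@CQuest P Sg) a (hat_dual G).
Proof.
elim=> [|i A ia|G1 G2 _ IH1 _ IH2]; first exact: licensed_empty.
  exact: licensed_form.
by rewrite hat_dual_pair; apply: licensed_pair.
Qed.

Lemma upset_hat_dual i (G G' : structure iformula) :
  upset (@IBang P Sg) i G G' ->
  upset (@CQuest P Sg) i (hat_dual G) (hat_dual G').
Proof.
elim=> [|j A ij|k A ik kW|G1 G1' G2 G2' _ IH1 _ IH2].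
- exact: upset_empty.
- exact: upset_keep.
- exact: upset_erase.
- by rewrite !hat_dual_pair; apply: upset_pair.
Qed.

(** Re-rooting: with [R] outside [K], this gathers all the surroundings of the hole into one
    structure, as they stand once exchange and associativity have brought the hole to the root. *)
Fixpoint residue (F : Type) (K : context F) (R : structure F) : structure F :=
  match K with
  | Hole => R
  | CtxL K D => residue K (pair D R)
  | CtxR G K => residue K (pair R G)
  end.

Lemma residue_neq0 (F : Type) (K : context F) R :
  R <> empty -> residue K R <> empty.
Proof.
elim: K R => [//|K IH D|G K IH] R R0 /=; apply: IH; first exact: pair_neq0.
by case: R R0 => // s _; case: G.
Qed.

Lemma CacLL_residue K (D R : structure cformula) :
  CacLL (pair (fill K D) R) <-> CacLL (pair D (residue K R)).
Proof.
elim: K R => [//|K IH E|G K IH] R /=; rewrite -IH.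
  by split=> H; [apply: c_assocr|apply: c_assocl].
by split=> /c_exch H; apply: c_exch; [apply: c_assocl|apply: c_assocr].
Qed.

Lemma acLL_CacLL (G : structure iformula) (A : iformula) :
  acLL G A -> CacLL (pair (hat_dual G) (form (hat A))).
Proof.
elim=> {G A}.
- by move=> A; apply/c_exch/c_init.
- move=> K D A B _ IH1 _; rewrite !hat_dual_fill => /CacLL_residue IH2.
  apply/CacLL_residue; apply: c_cut IH1 IH2.
  (* The side condition of [c_cut] holds because the residue still contains the succedent. *)
  exact/pair_neq0/residue_neq0.
- move=> K A B C _; rewrite !hat_dual_fill hat_dual_pair => IH.
  exact: (@c_par _ _ (CtxL _ (form (hat C)))).
- by move=> G D A B _ IH1 _ IH2; rewrite hat_dual_pair; apply: c_tensor.
- move=> K D A B C _ IH1 _; rewrite !hat_dual_fill hat_dual_pair.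
  move=> /CacLL_residue /c_exch IH2; apply/CacLL_residue.
  (* The dual of the par that encodes an implication is a tensor, so the left rule becomes
     [c_tensor] at the root. *)
  rewrite [hat_dual (form _)]/= dual_dual; apply/c_assocl/c_exch; exact: c_tensor.
- move=> G A B _; rewrite hat_dual_pair => /c_assocr IH.
  exact: (@c_par _ _ (CtxR _ Hole)).
- move=> K D A B C _ IH1 _; rewrite !hat_dual_fill hat_dual_pair.
  move=> /CacLL_residue /c_exch IH2; apply/CacLL_residue.
  rewrite [hat_dual (form _)]/= dual_dual; apply/c_exch/c_assocr; exact: c_tensor.
- move=> G A B _; rewrite hat_dual_pair => /c_assocr /c_exch /c_assocr IH.
  exact: (@c_par _ _ (CtxR _ Hole)).
- move=> K A B C _; rewrite !hat_dual_fill => IH.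
  exact: (@c_plus1 _ _ (CtxL _ (form (hat C)))).
- move=> K A B C _; rewrite !hat_dual_fill => IH.
  exact: (@c_plus2 _ _ (CtxL _ (form (hat C)))).
- by move=> G A B _ IH1 _ IH2; apply: (@c_with _ _ (CtxR _ Hole)).
- move=> K A B C _ + _; rewrite !hat_dual_fill => IH1 IH2.
  exact: (@c_with _ _ (CtxL _ (form (hat C)))).
- by move=> G A B _ IH; apply: (@c_plus1 _ _ (CtxR _ Hole)).
- by move=> G A B _ IH; apply: (@c_plus2 _ _ (CtxR _ Hole)).
- move=> K C _; rewrite !hat_dual_fill => IH.
  exact: (@c_bot _ _ (CtxL _ (form (hat C)))).
- exact: c_one.
- by move=> G; apply: (@c_top _ _ (CtxR _ Hole)).
- move=> K i A C _; rewrite !hat_dual_fill => IH.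
  exact: (@c_quest _ _ (CtxL _ (form (hat C)))).
- by move=> G G' i A /upset_hat_dual GG' _ IH; apply: c_bang IH.
- move=> K D C /licensed_hat_dual DW _; rewrite !hat_dual_fill => IH.
  exact: (@c_W _ _ (CtxL _ (form (hat C)))).
(* Reversal swaps the two holes, hence the two contraction rules; the two exchange rules are swapped
   below for the same reason. *)
- move=> K K1 K2 D C /licensed_hat_dual DC _; rewrite !hat_dual_fill2.
  exact: (@c_C2 _ _ (CtxL _ (form (hat C)))).
- move=> K K1 K2 D C /licensed_hat_dual DC _; rewrite !hat_dual_fill2.
  exact: (@c_C1 _ _ (CtxL _ (form (hat C)))).
- move=> K D1 D2 C /licensed_hat_dual DE _; rewrite !hat_dual_fill !hat_dual_pair.
  exact: (@c_E2 _ _ (CtxL _ (form (hat C)))).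
- move=> K D1 D2 C /licensed_hat_dual DE _; rewrite !hat_dual_fill !hat_dual_pair.
  exact: (@c_E1 _ _ (CtxL _ (form (hat C)))).
- move=> K D1 D2 D3 C /licensed_hat_dual DA _; rewrite !hat_dual_fill !hat_dual_pair.
  exact: (@c_A1 _ _ (CtxL _ (form (hat C)))).
- move=> K D1 D2 D3 C /licensed_hat_dual DA _; rewrite !hat_dual_fill !hat_dual_pair.
  exact: (@c_A2 _ _ (CtxL _ (form (hat C)))).
Qed.

End Soundness.

(** * The phase semantics *)

Section Phase.

Context (P : Type) (Sg : signature).

Notation iformula := (iform P Sg).
Notation cformula := (cform P Sg).

(** * Points, their product and the pole *)

Inductive point :=
| Neg (G : structure iformula)
| Pos (K : context iformula) (C : iformula)
| Many.

(** Composing with nothing when [D] is empty makes [one] a strict unit. *)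
Definition snocL (K : context iformula) (D : structure iformula) :=
  match D with None => K | Some _ => compose K (CtxL Hole D) end.

Definition snocR (K : context iformula) (G : structure iformula) :=
  match G with None => K | Some _ => compose K (CtxR G Hole) end.

Lemma fill_snocL K D G : fill (snocL K D) G = fill K (pair G D).
Proof. by case: D => [t|] /=; rewrite ?fill_compose ?pairG0. Qed.

Lemma fill_snocR K D G : fill (snocR K G) D = fill K (pair G D).
Proof. by case: G => [t|] /=; rewrite ?fill_compose. Qed.

(** The antecedent is reversed, as in [hat_dual].  When one side is [Pos K C],
    the hole of the product is the new root, seen from the leaf [C]. *)
Definition mul (x y : point) : point :=
  match x, y with
  | Neg G, Neg D => Neg (pair D G)
  | Neg G, Pos K C => Pos (snocR K G) C
  | Pos K C, Neg D => Pos (snocL K D) C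
  | _, _ => Many
  end.

Definition one : point := Neg empty.

Definition pole (x : point) : Prop :=
  match x with
  | Neg _ => False
  | Pos K C => acLL (fill K empty) C
  | Many => True
  end.

Lemma mulx1 x : mul x one = x.
Proof. by case: x. Qed.

Lemma mul1x x : mul one x = x.
Proof. by case: x => [G|K C|] //=; rewrite pairG0. Qed.

Lemma poleC x y : pole (mul x y) <-> pole (mul y x).
Proof.
by case: x y => [G|K C|] [D|L B|] //=; rewrite fill_snocL fill_snocR pairG0.
Qed.

(** [mul] itself is not associative: products of [Neg] points are bracketed trees. The pole does not
    see this: without a [Pos] or [Many] factor both sides are false, and with a single [Pos] among
    [Neg] factors both are the same two-sided sequent. *)
Lemma poleA x y z : pole (mul (mul x y) z) <-> pole (mul x (mul y z)).
Proof.
by case: x y z => [G|K C|] [D|L B|] [E|M A|] //=;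
  rewrite ?(fill_snocL, fill_snocR) /= ?pairG0.
Qed.

Lemma pole_rot x y z : pole (mul (mul x y) z) <-> pole (mul y (mul z x)).
Proof. by rewrite poleA poleC poleA. Qed.

Lemma pole_Neg G x :
  pole (mul (Neg G) x) <->
  match x with
  | Neg _ => False
  | Pos K C => acLL (fill K G) C
  | Many => True
  end.
Proof. by case: x => //= K C; rewrite fill_snocR pairG0. Qed.

(** * Orthogonality and closed sets *)

Definition orth (X : point -> Prop) (y : point) : Prop :=
  forall x, X x -> pole (mul x y).

Definition biorth (X : point -> Prop) := orth (orth X).

Definition prod (X Y : point -> Prop) (z : point) : Prop :=
  exists x y, X x /\ Y y /\ z = mul x y.

Lemma sub_biorth (X : point -> Prop) x : X x -> biorth X x.
Proof. by move=> Xx y Xy; apply/poleC/Xy. Qed.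

Lemma orth_sub (X Y : point -> Prop) :
  (forall x, X x -> Y x) -> forall x, orth Y x -> orth X x.
Proof. by move=> XY x Yx y /XY; apply: Yx. Qed.

Lemma orth_ext (X Y : point -> Prop) :
  (forall x, X x <-> Y x) -> forall x, orth X x <-> orth Y x.
Proof. by move=> XY x; split; apply: orth_sub => y /XY. Qed.

Lemma prod_ext (X X' Y Y' : point -> Prop) :
  (forall x, X x <-> X' x) -> (forall x, Y x <-> Y' x) ->
  forall x, prod X Y x <-> prod X' Y' x.
Proof.
by move=> XX' YY' x; split=> -[a [b [/XX' Xa [/YY' Yb ->]]]]; exists a, b.
Qed.

Lemma orth3 (X : point -> Prop) x : orth (biorth X) x <-> orth X x.
Proof. by split; [apply: orth_sub => y; apply: sub_biorth|apply: sub_biorth]. Qed.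

Lemma biorth_sub (X Y : point -> Prop) :
  (forall x, X x -> Y x) -> forall x, biorth X x -> biorth Y x.
Proof. by move=> XY; apply: orth_sub; apply: orth_sub. Qed.

Lemma biorth_elim (X : point -> Prop) x z :
  (forall y, X y -> pole (mul y z)) -> biorth X x -> pole (mul x z).
Proof. by move=> Xz XXx; apply/poleC/XXx. Qed.

(** One factor at a time is brought to the root by [poleA] and [pole_rot], where [biorth_elim]
    replaces it by a generator. *)
Lemma biorth_mul (X Y Z : point -> Prop) x y :
  (forall a b, X a -> Y b -> Z (mul a b)) ->
  biorth X x -> biorth Y y -> biorth Z (mul x y).
Proof.
move=> XYZ Xx Yy z Zz; apply/poleC/poleA.
apply: biorth_elim Xx => a Xa; apply/poleA/pole_rot.
apply: biorth_elim Yy => b Yb; apply/pole_rot/Zz; exact: XYZ.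
Qed.

(** All the leaves are of the form [IBang j A] with [j] above [i]. *)
Inductive banged (i : Sg) : structure iformula -> Prop :=
| banged_empty : banged i empty
| banged_form j A : label_le i j -> banged i (form (IBang j A))
| banged_pair G D : banged i G -> banged i D -> banged i (pair G D).

Lemma banged_upset i G : banged i G -> upset (@IBang P Sg) i G G.
Proof.
elim=> [|j A ij|G1 G2 _ IH1 _ IH2]; first exact: upset_empty.
  exact: upset_keep.
exact: upset_pair.
Qed.

Lemma banged_licensed i a G :
  axioms i a -> banged i G -> licensed (@IBang P Sg) a G.
Proof.
move=> ia; elim=> [|j A ij|G1 G2 _ IH1 _ IH2]; first exact: licensed_empty.
  by apply: licensed_form; apply: axioms_upward ia.
exact: licensed_pair.
Qed.

Lemma banged_le i j G : label_le i j -> banged j G -> banged i G.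
Proof.
have [_ le_trans] := @label_preorder Sg.
move=> ij; elim=> [|k A jk|G1 G2 _ IH1 _ IH2]; first exact: banged_empty.
  by apply: banged_form; apply: le_trans jk.
exact: banged_pair.
Qed.

(** * Denotations of formulae *)

Definition bang (i : Sg) (X : point -> Prop) (x : point) : Prop :=
  X x /\ exists2 G, x = Neg G & banged i G.

(** The factors of a tensor are swapped to agree with the reversal in [dual], which [sem_dual] turns
    into orthogonality. *)
Fixpoint sem (A : cformula) : point -> Prop :=
  match A with
  | CAtom p => orth (eq (Pos Hole (IAtom p)))
  | CNAtom p => biorth (eq (Pos Hole (IAtom p)))
  | CTensor A B => biorth (prod (sem B) (sem A))
  | CPar A B => orth (prod (orth (sem A)) (orth (sem B)))
  | CWith A B => fun x => sem A x /\ sem B x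
  | CPlus A B => orth (fun x => orth (sem A) x /\ orth (sem B) x)
  | CBang i A => biorth (bang i (sem A))
  | CQuest i A => orth (bang i (orth (sem A)))
  | COne => biorth (eq one)
  | CBot => orth (eq one)
  | CTop => fun _ => True
  | CZero => orth (fun _ => True)
  end.

(** Every clause of [sem] is an orthogonal, hence closed, except an intersection of closed sets for
    [CWith] and the whole space for [CTop]. *)
Lemma sem_biorth A x : biorth (sem A) x <-> sem A x.
Proof.
split; last exact: sub_biorth.
elim: A x => [p|p|A _ B _|A _ B _|A IHA B IHB|A _ B _|i A _|i A _||||] x;
  try exact: (proj1 (orth3 _ _)).
- by move=> ABx; split; [apply: IHA|apply: IHB];
    apply: biorth_sub ABx => y [].
- by [].
Qed.

Lemma bang_ext i (X Y : point -> Prop) :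
  (forall x, X x <-> Y x) -> forall x, bang i X x <-> bang i Y x.
Proof. by move=> XY x; rewrite /bang XY. Qed.

Lemma sem_dual A x : sem (dual A) x <-> orth (sem A) x.
Proof.
have orth_dual B : (forall x, sem (dual B) x <-> orth (sem B) x) ->
    forall x, orth (sem (dual B)) x <-> sem B x.
  by move=> HB y; rewrite -(sem_biorth B); apply: orth_ext.
elim: A x => [p|p|A IHA B IHB|A IHA B IHB|A IHA B IHB|A IHA B IHB|i A IH|i A IH||||]
  x //=; rewrite ?orth3 //.
- by apply: orth_ext; apply: prod_ext; apply: orth_dual.
- by apply: orth_ext; apply: orth_ext; apply: prod_ext.
- by apply: orth_ext => y; rewrite !orth_dual.
- apply: (iff_trans (iff_sym (sem_biorth (CWith (dual A) (dual B)) x))).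
  by apply: orth_ext; apply: orth_ext => y /=; rewrite IHA IHB.
- by apply: orth_ext; apply: bang_ext; apply: orth_dual.
- by apply: orth_ext; apply: orth_ext; apply: bang_ext.
- by split=> // _; apply: sub_biorth.
Qed.

(** Only the points [Pos K C] test a [Neg] point in a nontrivial way, so a left rule that applies in
    every context transfers membership from its premise to its conclusion. *)
Lemma biorth_antecedent (X : point -> Prop) G G' :
  (forall K C, acLL (fill K G) C -> acLL (fill K G') C) ->
  biorth X (Neg G) -> biorth X (Neg G').
Proof.
move=> GG' XG x Xx; apply/poleC; move/poleC: (XG x Xx).
by rewrite !pole_Neg; case: x {Xx} => // K C; apply: GG'.
Qed.

Lemma sem_antecedent A G G' :
  (forall K C, acLL (fill K G) C -> acLL (fill K G') C) ->
  sem A (Neg G) -> sem A (Neg G').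
Proof. by move=> GG'; rewrite -!(sem_biorth A); apply: biorth_antecedent. Qed.

Lemma pole_Pos A x :
  pole (mul x (Pos Hole A)) <-> match x with Neg G => acLL G A | _ => True end.
Proof. by case: x => //= G; rewrite fill_snocR pairG0. Qed.

(** For each compound connective, the left rules yield the first half and the right rules the
    second. *)
Lemma sem_hat A :
  sem (hat A) (Neg (form A)) /\ orth (sem (hat A)) (Pos Hole A).
Proof.
elim: A => [p|A [nA pA] B [nB pB]|A [nA pA] B [nB pB]|B [nB pB] A [nA pA]
  |A [nA pA] B [nB pB]|A [nA pA] B [nB pB]|i A [nA pA]||] /=.
- split; last exact: sub_biorth.
  by move=> _ <-; apply/poleC/pole_Pos/i_init.
- split.
    apply: (@biorth_antecedent _ (pair (form A) (form B))).
      by move=> K C; apply: i_tensorL.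
    by apply: sub_biorth; exists (Neg (form B)), (Neg (form A)).
  rewrite orth3 => _ [x [y [/pB + [/pA + ->]]]].
  by rewrite !pole_Pos; case: x y => [D|L ?|] [G|K ?|] //= DB GA; apply: i_tensorR.
- have semA x : orth (sem (dual (hat A))) x <-> sem (hat A) x.
    by rewrite -(sem_dual (dual (hat A))) dual_dual.
  split.
    move=> _ [x [y [/semA /pA + [/(_ _ nB) + ->]]]].
    rewrite pole_Pos pole_Neg poleC pole_Neg.
    case: x y => [G|K D|] [E|L C|] //= GA LB.
    by rewrite fill_snocR; apply: i_impL.
  move=> x xAB; apply/pole_Pos; case: x xAB => // G GAB. apply: i_impR.
  (* Testing [Neg G] against this product gives the premise of [i_impR]; the split on [G] follows
     the two cases of [snocL]. *)
  suff: pole (mul (mul (Neg (form A)) (Pos Hole B)) (Neg G)).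
    by case: G {GAB}.
  by apply: GAB; exists (Neg (form A)), (Pos Hole B); rewrite semA.
- have semA x : orth (sem (dual (hat A))) x <-> sem (hat A) x.
    by rewrite -(sem_dual (dual (hat A))) dual_dual.
  split.
    move=> _ [y [x [/(_ _ nB) + [/semA /pA + ->]]]].
    rewrite pole_Pos pole_Neg poleC pole_Neg.
    case: x y => [G|K D|] [E|L C|] //= LB GA.
    by rewrite fill_snocL; apply: i_pmiL.
  move=> x xAB; apply/pole_Pos; case: x xAB => // G GAB; apply: i_pmiR.
  suff: pole (mul (mul (Pos Hole B) (Neg (form A))) (Neg G)).
    by case: G {GAB}.
  by apply: GAB; exists (Pos Hole B), (Neg (form A)); rewrite semA.
- split.
    split.
      by apply: sem_antecedent nA => K C; apply: i_withL1.
    by apply: sem_antecedent nB => K C; apply: i_withL2.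
  move=> x [Ax Bx]; move: {Ax Bx} (pA _ Ax) (pB _ Bx); rewrite !pole_Pos.
  by case: x => // G; apply: i_withR.
- split.
    move=> x [/(_ _ nA) + /(_ _ nB)]; rewrite [pole (mul x _)]poleC !pole_Neg.
    case: x => // K C; exact: i_plusL.
  apply/sub_biorth; split=> x.
    by move=> /pA; rewrite !pole_Pos; case: x => // G; apply: i_plusR1.
  by move=> /pB; rewrite !pole_Pos; case: x => // G; apply: i_plusR2.
- split.
    apply: sub_biorth; split.
      by apply: sem_antecedent nA => K C; apply: i_bangL.
    exists (form (IBang i A)) => //; apply: banged_form.
    by have [le_refl _] := @label_preorder Sg; apply: le_refl.
  rewrite orth3 => x [Ax [G xG /banged_upset iG]]; move: (pA _ Ax); rewrite xG.
  by rewrite !pole_Pos; apply: i_bangR.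
- split.
    apply: (@biorth_antecedent _ empty); first by move=> K C; apply: i_oneL.
    exact: sub_biorth.
  by rewrite orth3 => _ <-; apply/pole_Pos/i_oneR.
- by split=> // x _; apply/pole_Pos; case: x => // G; apply: i_topR.
Qed.

(** * Denotations of structures, and the structural rules *)

Fixpoint denotes_tree (t : tree cformula) : point -> Prop :=
  match t with
  | Leaf A => sem (dual A)
  | Node s t => prod (denotes_tree s) (denotes_tree t)
  end.

(** Products are not closed here, so that a point of a structure splits into one point for each
    leaf. Closure is recovered where needed by [biorth_mul]. *)
Definition denotes (G : structure cformula) : point -> Prop :=
  match G with
  | None => eq one
  | Some t => denotes_tree t
  end.

Lemma denotes_pair G D z :
  denotes (pair G D) z <-> prod (denotes G) (denotes D) z.
Proof.
case: G D => [s|] [t|] //=; split.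
- by move=> zs; exists z, one; rewrite mulx1.
- by move=> [x [_ [xs [<- ->]]]]; rewrite mulx1.
- by move=> zt; exists one, z; rewrite mul1x.
- by move=> [_ [y [<- [yt ->]]]]; rewrite mul1x.
- by move=> <-; exists one, one; rewrite mulx1.
- by move=> [_ [_ [<- [<- ->]]]]; rewrite mulx1.
Qed.

(** Each choice of points for the side structures gives one function of the point at the hole. The
    equations are pointwise, which avoids functional extensionality. *)
Fixpoint denotes_context (K : context cformula) (h : point -> point) : Prop :=
  match K with
  | Hole => forall x, h x = x
  | CtxL K D => exists g d,
      denotes_context K g /\ denotes D d /\ forall x, h x = mul (g x) d
  | CtxR G K => exists g d,
      denotes_context K g /\ denotes G d /\ forall x, h x = mul d (g x)
  end.

Lemma denotes_fill K D z :
  denotes (fill K D) z <->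
  exists h x, denotes_context K h /\ denotes D x /\ z = h x.
Proof.
elim: K z => [|K IH E|G K IH] z /=.
- split=> [Dz|[h [x [hE [Dx ->]]]]]; last by rewrite hE.
  by exists (fun x => x), z.
- rewrite denotes_pair; split=> [[y [e [/IH [h [x [hK [Dx ->]]]] [Ee ->]]]]|].
    exists (fun x => mul (h x) e), x; split=> //; by exists h, e.
  move=> [_ [x [[h [e [hK [Ee ->]]]] [Dx ->]]]].
  exists (h x), e; split=> //; apply/IH; by exists h, x.
- rewrite denotes_pair; split=> [[e [y [Ee [/IH [h [x [hK [Dx ->]]]] ->]]]]|].
    exists (fun x => mul e (h x)), x; split=> //; by exists h, e.
  move=> [_ [x [[h [e [hK [Ee ->]]]] [Dx ->]]]].
  exists e, (h x); split=> //; split=> //; apply/IH; by exists h, x.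
Qed.

(** The semantic counterpart of [CacLL_residue]: rotation moves everything around the hole into a
    single point. *)
Lemma context_residue K h :
  denotes_context K h ->
  forall s, exists r, forall x, pole (mul (h x) s) <-> pole (mul x r).
Proof.
elim: K h => [|K IH E|G K IH] h /=.
- by move=> hE s; exists s => x; rewrite hE.
- move=> [g [e [gK [_ hE]]]] s; have [r rP] := IH g gK (mul e s).
  by exists r => x; rewrite hE poleA.
- move=> [g [e [gK [_ hE]]]] s; have [r rP] := IH g gK (mul s e).
  by exists r => x; rewrite hE pole_rot.
Qed.

Definition valid (G : structure cformula) : Prop :=
  forall x, denotes G x -> pole x.

Definition residual (K : context cformula) (r : point) : Prop :=
  exists2 h, denotes_context K h & forall x, pole (h x) <-> pole (mul x r).

Lemma valid_fill K D :
  valid (fill K D) <->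
  forall r, residual K r -> forall x, denotes D x -> pole (mul x r).
Proof.
split=> [KD r [h hK hr] x Dx|KD z /denotes_fill [h [x [hK [Dx ->]]]]].
  by apply/hr/KD/denotes_fill; exists h, x.
have [r rP] := context_residue hK one.
have hr x' : pole (h x') <-> pole (mul x' r) by rewrite -rP mulx1.
by apply/hr; apply: KD Dx; exists h.
Qed.

(** Since [sem A] is closed, a rule acting on a formula in context reduces to a relation between
    denotations. *)
Lemma valid_fill_form K A :
  valid (fill K (form A)) <-> forall r, residual K r -> sem A r.
Proof.
rewrite valid_fill; split=> H r Kr.
  by apply/sem_biorth => x /sem_dual Ax; apply: H.
by move=> x /sem_dual Ax; apply/poleC/Ax/H.
Qed.

Lemma licensed_denotes a D x :
  licensed (@CQuest P Sg) a D -> denotes D x ->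
  biorth (fun y => denotes D y /\
    exists2 G, y = Neg G & licensed (@IBang P Sg) a G) x.
Proof.
move=> Da; elim: Da x => [|i A ia|D1 D2 _ IH1 _ IH2] x.
- move=> <-; apply: sub_biorth; split=> //.
  by exists empty => //; apply: licensed_empty.
- move=> Ax; apply: biorth_sub Ax => y yA; split; first exact: sub_biorth.
  by case: yA => _ [G -> iG]; exists G => //; apply: banged_licensed iG.
- move=> /denotes_pair [y1 [y2 [/IH1 Dy1 [/IH2 Dy2 ->]]]].
  apply: biorth_mul Dy1 Dy2 => z1 z2 [Dz1 [G1 zG1 aG1]] [Dz2 [G2 zG2 aG2]].
  split; first by apply/denotes_pair; exists z1, z2.
  by exists (pair G2 G1); [rewrite zG1 zG2|apply: licensed_pair].
Qed.

(** The dual of a [CQuest] leaf denotes the closure of a set of banged antecedents, so structural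
    rules need checking on licensed antecedents only, where [acLL] has them. *)
Lemma pole_licensed a D x z :
  licensed (@CQuest P Sg) a D -> denotes D x ->
  (forall G, licensed (@IBang P Sg) a G -> denotes D (Neg G) ->
    pole (mul (Neg G) z)) ->
  pole (mul x z).
Proof.
move=> Da Dx Dz; apply: biorth_elim (licensed_denotes Da Dx).
by move=> y [Dy [G yG aG]]; rewrite yG in Dy *; apply: Dz.
Qed.

Lemma pole_W G z :
  licensed (@IBang P Sg) AxW G -> pole (mul one z) -> pole (mul (Neg G) z).
Proof. by rewrite !pole_Neg; case: z => // K C; apply: i_W. Qed.

(** If the succedent lies in [z], then [G] is exchanged with the antecedent [y]; if it lies in [y],
    then with the antecedent [z]. *)
Lemma pole_E G y z :
  licensed (@IBang P Sg) AxE G ->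
  pole (mul (mul y (Neg G)) z) <-> pole (mul (mul (Neg G) y) z).
Proof.
move=> EG; case: y => [D|K C|] //=.
  rewrite !pole_Neg; case: z => // K C.
  by split; [apply: i_E2|apply: i_E1].
case: z => //= D; rewrite !(fill_snocL, fill_snocR) /=.
by split; [apply: i_E1|apply: i_E2].
Qed.

(** Either argument may fill the left hole, because the order of the holes in the antecedent depends
    on where the succedent lies. *)
Definition two_holes (g : structure iformula -> structure iformula ->
    structure iformula) : Prop :=
  exists K K1 K2, (forall G D, g G D = fill2 K K1 K2 G D) \/
    (forall G D, g G D = fill2 K K2 K1 D G).

Lemma two_holes_flip g : two_holes g -> two_holes (fun G D => g D G).
Proof. by move=> [K [K1 [K2 [gE|gE]]]]; exists K, K2, K1; [right|left]. Qed.

Lemma two_holes_fill g K :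
  two_holes g -> two_holes (fun G D => g G (fill K D)).
Proof.
move=> [L [L1 [L2 [gE|gE]]]]; exists L, L1, (compose L2 K); [left|right] => G D;
  by rewrite gE /fill2 fill_compose.
Qed.

Lemma two_holes_contraction g G C :
  two_holes g -> licensed (@IBang P Sg) AxC G -> acLL (g G G) C ->
  acLL (g G empty) C /\ acLL (g empty G) C.
Proof.
move=> [K [K1 [K2 [gE|gE]]]] CG; rewrite !gE => GC.
  by split; [apply: i_C1|apply: i_C2].
by split; [apply: i_C2|apply: i_C1].
Qed.

(** In the second case, seen from the leaf [C], the hole of [h] and the root of
    the one-sided structure are two holes of the antecedent. *)
Lemma context_Neg K h :
  denotes_context K h ->
  (exists L, forall G, h (Neg G) = Neg (fill L G)) \/
  (exists g C, two_holes g /\ forall G, exists2 L, h (Neg G) = Pos L C &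
    forall D, fill L D = g G D) \/
  (forall G, h (Neg G) = Many).
Proof.
elim: K h => [|K IH E|E K IH] h /=.
- by move=> hE; left; exists Hole => G; rewrite hE.
- move=> [f [d [/IH fK [_ hE]]]].
  case: fK => [[L fE]|[[g [C [g2 gE]]]|fE]].
  + case: d hE => [D|M C|] hE.
    * by left; exists (CtxR D L) => G; rewrite hE fE.
    * right; left; exists (fun G D => fill2 M L Hole G D), C.
      split; first by exists M, L, Hole; left.
      move=> G; exists (snocR M (fill L G)); first by rewrite hE fE.
      by move=> D; rewrite fill_snocR.
    * by right; right=> G; rewrite hE fE.
  + case: d hE => [D|M B|] hE.
    * right; left; exists (fun G T => g G (pair T D)), C.
      split; first exact: (two_holes_fill (CtxL Hole D)).
      move=> G; have [L LE LP] := gE G; exists (snocL L D); first by rewrite hE LE.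
      by move=> T; rewrite fill_snocL LP.
    * by right; right=> G; have [L LE _] := gE G; rewrite hE LE.
    * by right; right=> G; have [L LE _] := gE G; rewrite hE LE.
  + by right; right=> G; rewrite hE fE.
- move=> [f [d [/IH fK [_ hE]]]].
  case: fK => [[L fE]|[[g [C [g2 gE]]]|fE]].
  + case: d hE => [D|M C|] hE.
    * by left; exists (CtxL L D) => G; rewrite hE fE.
    * right; left; exists (fun G D => fill2 M Hole L D G), C.
      split; first by exists M, L, Hole; right.
      move=> G; exists (snocL M (fill L G)); first by rewrite hE fE.
      by move=> D; rewrite fill_snocL.
    * by right; right=> G; rewrite hE fE.
  + case: d hE => [D|M B|] hE.
    * right; left; exists (fun G T => g G (pair D T)), C.
      split; first exact: (two_holes_fill (CtxR D Hole)).
      move=> G; have [L LE LP] := gE G; exists (snocR L D); first by rewrite hE LE.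
      by move=> T; rewrite fill_snocR LP.
    * by right; right=> G; have [L LE _] := gE G; rewrite hE LE.
    * by right; right=> G; have [L LE _] := gE G; rewrite hE LE.
  + by right; right=> G; rewrite hE fE; case: d {hE}.
Qed.

(** If exactly one of the three factors carries a single succedent, the other two are plugged into
    its antecedent. Otherwise the truth value is constant: false with no succedent, true with
    several. *)
Lemma context_Neg2 K1 K2 h1 h2 r :
  denotes_context K1 h1 -> denotes_context K2 h2 ->
  (exists Q : Prop, forall G D, pole (mul (mul (h1 (Neg G)) (h2 (Neg D))) r) <-> Q) \/
  (exists g C, two_holes g /\ forall G D,
    pole (mul (mul (h1 (Neg G)) (h2 (Neg D))) r) <-> acLL (g G D) C).
Proof.
move=> /context_Neg h1P /context_Neg h2P.
case: h1P => [[L1 E1]|[[g1 [C1 [g1P E1]]]|E1]]; last first.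
- by left; exists True => G D; rewrite E1.
- case: h2P => [[L2 E2]|[[g2 [C2 [g2P E2]]]|E2]].
  + case: r => [T|M B|].
    * right; exists (fun G D => g1 G (pair T (fill L2 D))), C1.
      split; first exact: (two_holes_fill (CtxR T L2)).
      move=> G D; have [L LE LP] := E1 G; rewrite LE E2 /=.
      by rewrite !fill_snocL LP.
    * by left; exists True => G D; have [L -> _] := E1 G; rewrite E2.
    * by left; exists True => G D; have [L -> _] := E1 G; rewrite E2.
  + left; exists True => G D.
    by have [L -> _] := E1 G; have [L' -> _] := E2 D.
  + by left; exists True => G D; have [L -> _] := E1 G; rewrite E2.
- case: h2P => [[L2 E2]|[[g2 [C2 [g2P E2]]]|E2]].
  + case: r => [T|M B|].
    * by left; exists False => G D; rewrite E1 E2.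
    * right; exists (fun G D => fill2 M L2 L1 D G), B.
      split; first by exists M, L1, L2; right.
      by move=> G D; rewrite E1 E2 pole_Neg.
    * by left; exists True => G D; rewrite E1 E2.
  + case: r => [T|M B|].
    * right; exists (fun G D => g2 D (pair (fill L1 G) T)), C2.
      split; first exact/two_holes_flip/(two_holes_fill (CtxL L1 T)).
      move=> G D; have [L LE LP] := E2 D; rewrite LE E1 /=.
      by rewrite fill_snocL fill_snocR LP.
    * by left; exists True => G D; have [L -> _] := E2 D; rewrite E1.
    * by left; exists True => G D; have [L -> _] := E2 D; rewrite E1.
  + by left; exists True => G D; rewrite E1 E2.
Qed.

Lemma pole_C K1 K2 h1 h2 r G :
  denotes_context K1 h1 -> denotes_context K2 h2 ->
  licensed (@IBang P Sg) AxC G ->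
  pole (mul (mul (h1 (Neg G)) (h2 (Neg G))) r) ->
  pole (mul (mul (h1 (Neg G)) (h2 one)) r) /\
  pole (mul (mul (h1 one) (h2 (Neg G))) r).
Proof.
move=> K1h K2h CG; rewrite /one.
case: (context_Neg2 r K1h K2h) => [[Q QE]|[g [C [g2 gE]]]]; first by rewrite !QE.
by rewrite !gE; apply: two_holes_contraction.
Qed.

(** On generators, a kept leaf serves as its own [G], while an erased one takes [G] empty and is
    restored by weakening. Thus promotion reduces to a banged antecedent of the premise. *)
Lemma upset_denotes i D D' x :
  upset (@CQuest P Sg) i D D' -> denotes D x ->
  biorth (fun y => exists2 G, banged i G & denotes D' (Neg G) /\
    forall z, pole (mul (Neg G) z) -> pole (mul y z)) x.
Proof.
move=> DD'; elim: DD' x => [|j A ij|k A ik kW|D1 D1' D2 D2' _ IH1 _ IH2] x.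
- by move=> <-; apply: sub_biorth; exists empty; first exact: banged_empty.
- move=> Ax; apply: biorth_sub Ax => y yA.
  case: (yA) => _ [G yG jG]; exists G; first exact: banged_le jG.
  by split; [rewrite -yG; apply: sub_biorth|rewrite yG].
- move=> Ax; apply: biorth_sub Ax => _ [_ [G -> kG]].
  exists empty; first exact: banged_empty.
  by split=> // z; apply/pole_W/(banged_licensed kW kG).
- move=> /denotes_pair [y1 [y2 [/IH1 Dy1 [/IH2 Dy2 ->]]]].
  apply: biorth_mul Dy1 Dy2 => z1 z2 [G1 iG1 [DG1 Gz1]] [G2 iG2 [DG2 Gz2]].
  exists (pair G2 G1); first exact: banged_pair.
  split; first by apply/denotes_pair; exists (Neg G1), (Neg G2).
  move=> z; rewrite -[Neg _]/(mul (Neg G1) (Neg G2)).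
  by rewrite poleA => /Gz1; rewrite -poleA pole_rot => /Gz2; rewrite -pole_rot.
Qed.

(** * Soundness of [CacLL] for validity *)

Lemma licensed_empty_axiom (F : Type) (mod : Sg -> F -> F) a D :
  (forall i : Sg, ~ axioms i a) -> licensed mod a D -> D = empty.
Proof. by move=> noa; elim=> [//|i A /noa//|G1 G2 _ -> _ ->]. Qed.

Lemma CacLL_valid (D : structure cformula) :
  (forall (i : Sg) a, axioms i a -> a = AxC \/ a = AxW \/ a = AxE) ->
  CacLL D -> valid D.
Proof.
move=> hSg.
have noA1 (i : Sg) : ~ axioms i AxA1 by move=> /hSg [|[]].
have noA2 (i : Sg) : ~ axioms i AxA2 by move=> /hSg [|[]].
elim=> {D}.
- move=> A _ /denotes_pair [x [y [Ax [/sem_dual Ay ->]]]].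
  exact: Ay.
- move=> G D A _ _ GA _ AD _ /denotes_pair [x [y [Gx [Dy ->]]]].
  (* Closedness of [sem A] turns the first premise into membership of [x], which the second premise
     then tests with [y]. *)
  have Ax : sem A x.
    apply/sem_biorth => z /sem_dual Az; apply/poleC/GA/denotes_pair.
    by exists x, z.
  by apply: AD; apply/denotes_pair; exists x, y; rewrite /= dual_dual.
- move=> G D _ GD _ /denotes_pair [y [x [Dy [Gx ->]]]].
  by apply/poleC/GD/denotes_pair; exists x, y.
- move=> G D T _ GDT _ /denotes_pair [_ [z [/denotes_pair [x [y [Gx [Dy ->]]]] [Tz ->]]]].
  apply/poleA/GDT/denotes_pair; exists x, (mul y z); split=> //; split=> //.
  by apply/denotes_pair; exists y, z.
- move=> G D T _ GDT _ /denotes_pair [x [_ [Gx [/denotes_pair [y [z [Dy [Tz ->]]]] ->]]]].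
  apply/poleA/GDT/denotes_pair; exists (mul x y), z; split=> //.
  by apply/denotes_pair; exists x, y.
- move=> G D A B _ GA _ DB _
    /denotes_pair [_ [z [/denotes_pair [y [x [Dy [Gx ->]]]] [/sem_dual ABz ->]]]].
  apply: ABz; apply: sub_biorth; exists y, x; split; [|split=> //].
    apply/sem_biorth => b /sem_dual Bb; apply/poleC/DB/denotes_pair.
    by exists y, b.
  apply/sem_biorth => a /sem_dual Aa; apply/poleC/GA/denotes_pair.
  by exists x, a.
- move=> K A B _ /valid_fill KAB; apply/valid_fill_form => r Kr.
  move=> _ [a [b [/sem_dual Aa [/sem_dual Bb ->]]]]; apply: KAB Kr _ _.
  by apply/denotes_pair; exists a, b.
- move=> K A B _ /valid_fill_form KA _ /valid_fill_form KB.
  by apply/valid_fill_form => r Kr; split; [apply: KA|apply: KB].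
- move=> K A B _ /valid_fill_form KA; apply/valid_fill_form => r Kr.
  by move=> z [Az _]; apply/poleC/Az/KA.
- move=> K A B _ /valid_fill_form KB; apply/valid_fill_form => r Kr.
  by move=> z [_ Bz]; apply/poleC/Bz/KB.
- by move=> x Ax; rewrite -(mul1x x); apply: Ax.
- move=> K _ /valid_fill K0; apply/valid_fill_form => r Kr _ <-.
  exact: K0 Kr _ _.
- by move=> K; apply/valid_fill_form.
- move=> K i A _ /valid_fill_form KA; apply/valid_fill_form => r Kr.
  by move=> z [Az _]; apply/poleC/Az/KA.
- move=> G G' i A GG' _ GA _ /denotes_pair [x [y [Gx [/sem_dual Ay ->]]]].
  apply: Ay => z Az; apply/poleC.
  apply: biorth_elim (upset_denotes GG' Gx) => w [H iH [GH]]; apply; apply: Az.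
  split; last by exists H.
  apply/sem_biorth => a /sem_dual Aa; apply/poleC/GA/denotes_pair.
  by exists (Neg H), a.
- move=> K D DW _ /valid_fill K0; apply/valid_fill => r Kr x Dx.
  apply: pole_licensed DW Dx _ => G GW _; apply: pole_W => //.
  exact: K0 Kr _ _.
- move=> K K1 K2 D DC _ /valid_fill KD; apply/valid_fill => r Kr.
  move=> _ /denotes_pair [_ [_ [/denotes_fill [h1 [x [K1h [Dx ->]]]]
    [/denotes_fill [h2 [_ [K2h [<- ->]]]] ->]]]].
  have [q qP] := context_residue K1h (mul (h2 one) r).
  (* The point [x] is rotated to the root, replaced there by a single antecedent [G], and rotated
     back; the same [G] then serves for both copies of [D]. *)
  apply/poleA/qP; apply: pole_licensed DC Dx _ => G GC DG; apply/qP/poleA.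
  suff: pole (mul (mul (h1 (Neg G)) (h2 (Neg G))) r).
    by case/(pole_C K1h K2h GC).
  apply: KD Kr _ _; apply/denotes_pair; exists (h1 (Neg G)), (h2 (Neg G)).
  by split; [|split=> //]; apply/denotes_fill; [exists h1, (Neg G)|exists h2, (Neg G)].
- move=> K K1 K2 D DC _ /valid_fill KD; apply/valid_fill => r Kr.
  move=> _ /denotes_pair [_ [_ [/denotes_fill [h1 [_ [K1h [<- ->]]]]
    [/denotes_fill [h2 [x [K2h [Dx ->]]]] ->]]]].
  have [q qP] := context_residue K2h (mul r (h1 one)).
  apply/pole_rot/qP; apply: pole_licensed DC Dx _ => G GC DG; apply/qP/pole_rot.
  suff: pole (mul (mul (h1 (Neg G)) (h2 (Neg G))) r).
    by case/(pole_C K1h K2h GC).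
  apply: KD Kr _ _; apply/denotes_pair; exists (h1 (Neg G)), (h2 (Neg G)).
  by split; [|split=> //]; apply/denotes_fill; [exists h1, (Neg G)|exists h2, (Neg G)].
- move=> K D1 D2 DE _ /valid_fill KD; apply/valid_fill => r Kr.
  move=> _ /denotes_pair [x [y [Dx [Dy ->]]]].
  apply/poleA; apply: pole_licensed DE Dx _ => G GE DG.
  apply/poleA/pole_E => //; apply: KD Kr _ _.
  by apply/denotes_pair; exists y, (Neg G).
- move=> K D1 D2 DE _ /valid_fill KD; apply/valid_fill => r Kr.
  move=> _ /denotes_pair [x [y [Dx [Dy ->]]]].
  apply/pole_rot; apply: pole_licensed DE Dy _ => G GE DG.
  apply/pole_rot/pole_E => //; apply: KD Kr _ _.
  by apply/denotes_pair; exists (Neg G), x.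
(* The restriction on the signature leaves only empty licensed structures for A1 and A2; erasure
   then makes premise and conclusion equal. *)
- move=> K D1 D2 D3 /(licensed_empty_axiom noA1) ->.
  by rewrite !pairG0.
- move=> K D1 D2 D3 /(licensed_empty_axiom noA2) ->.
  by [].
Qed.

(** * From validity back to intuitionistic derivability *)

Lemma denotes_hat_dual G : denotes (hat_dual G) (Neg G).
Proof.
case: G => [t|] //=; elim: t => [A|s IHs t IHt] /=.
  by rewrite dual_dual; case: (sem_hat A).
(* The reversal in [mul] cancels the one in [hat_dual]. *)
by apply/denotes_pair; exists (Neg (Some t)), (Neg (Some s)).
Qed.

(** The product of [Neg G] and [Pos Hole A] is a point of the translated sequent, and its membership
    in the pole is the original sequent. *)
Lemma valid_acLL G A :
  valid (pair (hat_dual G) (form (hat A))) -> acLL G A.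
Proof.
move=> GA; apply/(pole_Pos A (Neg G))/GA/denotes_pair.
exists (Neg G), (Pos Hole A); split; first exact: denotes_hat_dual.
by split=> //; apply/sem_dual; case: (sem_hat A).
Qed.

End Phase.

Theorem theorem3p1 (P : Type) (Sg : signature)
  (hSg : forall (i : Sg) (a : ax),
    axioms i a -> a = AxC \/ a = AxW \/ a = AxE)
  (G : structure (iform P Sg)) (A : iform P Sg) :
  acLL G A <-> CacLL (pair (hat_dual G) (form (hat A))).
Proof.
split; first exact: acLL_CacLL.
by move=> /(CacLL_valid hSg); apply: valid_acLL.
Qed.
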